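(* For any positive integers $m$ and $s$ and any nonempty set $K$, there exist a positive integer $n$ and an $\mathcal{S}_n$-invariant subset $V\subseteq K^{n}$ with $|V|=s$ such that, with $\mathcal{X}$ the set of $m\times n$ matrices over $K$ all of whose rows belong to $V$, \[ s^{m}=\sum_{[A]_{\mathrm{r,c}}\in \mathcal{X}/\overset{\mathrm{r,c}}{\sim}}\binom{m}{\operatorname{Mult}(\operatorname{row}_f(A))}\binom{n}{\operatorname{Mult}(\operatorname{col}(A))}, \] where the sum runs over the equivalence classes of $\overset{\mathrm{r,c}}{\sim}$ on $\mathcal{X}$ and $A$ is a representative of the class $[A]_{\mathrm{r,c}}$.
   Context: $\mathcal{S}_n$ is the symmetric group on $\{1,\ldots,n\}$. A finite set $V\subseteq K^n$ is $\mathcal{S}_n$-invariant if $\mathcal{S}_nV=V$, where $\mathcal{S}_nV=\{(r_{\sigma(1)},\ldots,r_{\sigma(n)}) : (r_1,\ldots,r_n)\in V,\ \sigma\in\mathcal{S}_n\}$. Given $m,n,K,V$, the set $\mathcal{X}$ consists of all $m\times n$ matrices with entries in $K$ whose rows $\boldsymbol{r}_1,\ldots,\boldsymbol{r}_m$ all lie in $V$. For a multiset $S$, $\operatorname{supp}(S)$ is the set of its distinct elements, $\operatorname{mult}_S(a)$ is the multiplicity of $a$ in $S$, and $\operatorname{Mult}(S)$ is the multiset $\{\operatorname{mult}_S(a) : a\in\operatorname{supp}(S)\}$, which has cardinality $|\operatorname{supp}(S)|$. For a positive integer $N$ and a multiset $S=\{r_1,\ldots,r_q\}$ of nonnegative integers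 (cardinality $q$ counted with multiplicity), $\binom{N}{S}:=\frac{N!}{r_1!\cdots r_q!}$ if $r_1+\cdots+r_q=N$, and $\binom{N}{S}:=0$ otherwise. For a matrix $A$ with columns $\boldsymbol{c}_1,\ldots,\boldsymbol{c}_n$, $\operatorname{col}(A)$ is the multiset $\{\boldsymbol{c}_1,\ldots,\boldsymbol{c}_n\}$. For a vector $\boldsymbol{r}=(r_1,\ldots,r_n)$, $f(\boldsymbol{r})$ is the multiset $\{r_1,\ldots,r_n\}$ of cardinality $n$. For a matrix $A$ with rows $\boldsymbol{r}_1,\ldots,\boldsymbol{r}_m$, $\operatorname{row}_f(A)$ is the multiset $\{f(\boldsymbol{r}_1),\ldots,f(\boldsymbol{r}_m)\}$. For $A,B\in\mathcal{X}$: $A\overset{\mathrm{c}}{\sim}B$ means $\operatorname{col}(A)=\operatorname{col}(B)$; $A\overset{\mathrm{r}}{\sim}B$ means $\operatorname{row}_f(A)=\operatorname{row}_f(B)$; and $A\overset{\mathrm{r,c}}{\sim}B$ means that both $A\overset{\mathrm{r}}{\sim}B$ and $A\overset{\mathrm{c}}{\sim}B$ hold. The relation $\overset{\mathrm{r,c}}{\sim}$ is an equivalence relation on $\mathcal{X}$, $\mathcal{X}/\overset{\mathrm{r,c}}{\sim}$ is the set of its equivalence classes, and $[A]_{\mathrm{r,c}}$ is the class of $A$.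
   Formalization: K is assumed to have at least two elements when s > 1: if K has one element then K^n is a single point, so no V with |V| = s > 1 exists and the claim as written fails. *)

(* Defs.v *)
From HB Require Import structures.
From mathcomp Require Import all_boot fingroup perm matrix.
From mathcomp Require Import finmap multiset boolp.
Set Implicit Arguments.
Unset Strict Implicit.
Unset Printing Implicit Defensive.

Local Open Scope fset_scope.
Local Open Scope mset_scope.
Local Open Scope nat_scope.

(* [Mult S]: one entry per distinct element of S, so that the values are
   collected with repetition. *)
Definition Mult (T : choiceType) (S : {mset T}) : {mset nat} :=
  seq_mset [seq S a | a <- finsupp S].

(* The division is exact: the product of the factorials divides N`!. *)
Definition multinomial (N : nat) (S : {mset nat}) : nat :=
  if \sum_(r <- S) r == N then N`! %/ \prod_(r <- S) r`! else 0.

Definition Sn_orbit (K : choiceType) (n : nat) (V : {fset 'rV[K]_n}) :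
    {fset 'rV[K]_n} :=
  [fset col_perm s r | r in V, s in [set: 'S_n]].

Definition Sn_invariant (K : choiceType) (n : nat) (V : {fset 'rV[K]_n}) :=
  Sn_orbit V = V.

Section Matrices.
Variables (K : choiceType) (m n : nat).

Definition mset_of_row (r : 'rV[K]_n) : {mset K} :=
  seq_mset [seq r ord0 j | j <- enum 'I_n].

Definition row_f (A : 'M[K]_(m, n)) : {mset {mset K}} :=
  seq_mset [seq mset_of_row (row i A) | i <- enum 'I_m].

Definition col_mset (A : 'M[K]_(m, n)) : {mset 'cV[K]_m} :=
  seq_mset [seq col j A | j <- enum 'I_n].

Definition c_equiv (A B : 'M[K]_(m, n)) : bool := col_mset A == col_mset B.
Definition r_equiv (A B : 'M[K]_(m, n)) : bool := row_f A == row_f B.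
Definition rc_equiv (A B : 'M[K]_(m, n)) : bool := r_equiv A B && c_equiv A B.

Definition mx_of_rows (V : {fset 'rV[K]_n}) (r : {ffun 'I_m -> V}) :
    'M[K]_(m, n) :=
  (\matrix_(i, j) val (r i) ord0 j)%R.

(* K may be infinite, so the matrices with rows in V are enumerated by their
   row functions; [in_rows_in] gives the membership condition. *)
Definition rows_in (V : {fset 'rV[K]_n}) : {fset 'M[K]_(m, n)} :=
  [fset mx_of_rows r | r in [set: {ffun 'I_m -> V}]].

Lemma in_rows_in (V : {fset 'rV[K]_n}) (A : 'M[K]_(m, n)) :
  (A \in rows_in V) = [forall i, row i A \in V].
Proof.
apply/imfsetP/forallP => /= [[r _ ->] i | h].
  suff -> : row i (mx_of_rows r) = val (r i) by exact: valP.
  by apply/rowP => j; rewrite !mxE.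
exists [ffun i => [` h i]]; first by rewrite inE.
by apply/matrixP => i j; rewrite mxE ffunE /= mxE.
Qed.

Definition rc_class (V : {fset 'rV[K]_n}) (A : 'M[K]_(m, n)) :
    {fset 'M[K]_(m, n)} :=
  [fset B in rows_in V | rc_equiv A B].

Definition rc_classes (V : {fset 'rV[K]_n}) : {fset {fset 'M[K]_(m, n)}} :=
  [fset rc_class V A | A in rows_in V].

End Matrices.

Arguments rc_classes {K} m {n} V.

(* K^n has a single point when K does, so a set V of size s > 1 requires K to
   have at least two elements. *)
Lemma card_fset_rV_le1 (K : choiceType) (n : nat) (V : {fset 'rV[K]_n}) :
  (forall x y : K, x = y) -> #|` V| <= 1.
Proof.
move=> K1; have [-> | [v vV]] := fset_0Vmem V; first by rewrite cardfs0.
rewrite -[leqRHS](cardfs1 v); apply: fsubset_leq_card; apply/fsubsetP => w _.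
by rewrite inE; apply/eqP/rowP => j; apply: K1.
Qed.

(* Main.v *)
Require Import Defs.
From HB Require Import structures.
From mathcomp Require Import all_boot fingroup perm matrix.
From mathcomp Require Import finmap multiset boolp.

(** The identity counts the [s ^ m] matrices with rows in [V] class by class,
    for a [V] in which row permutations carry no information.  Take [n = s],
    two elements [x] and [y] of [K] (distinct if [1 < s]), and let [V] consist
    of the [n] vectors with one entry [x] and all others [y]; this is a single
    orbit of the symmetric group ([marked_rows_invariant],
    [card_marked_rows]).

    All vectors of [V] have the same multiset of entries
    ([mset_of_marked_row]).  Hence the row invariant is constant on the
    matrices considered: the classes are those of column equivalence, and the
    factor coming from the rows is the multinomial coefficient of a constant
    word, namely 1.

    As [V] is invariant, permuting the columns of a matrix with rows in [V]
    keeps its rows in [V].  The class of [A] therefore corresponds to all the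
    words that are rearrangements of the word of columns of [A]
    ([card_c_class]), and the number of rearrangements of a word of length [N]
    is [N!] over the product of the factorials of its letter counts
    ([size_permutations_mul_fact]).  So the summand of each class is its
    cardinality, and the classes partition the matrices
    ([sum_card_rc_classes]). *)

Local Open Scope fset_scope.
Local Open Scope mset_scope.
Local Open Scope nat_scope.

Section Multinomial.

Lemma sum_count_mem (T : eqType) (u s : seq T) :
  uniq u -> {subset s <= u} -> \sum_(x <- u) count_mem x s = size s.
Proof.
move=> u_uniq su.
under eq_bigr => x _ do rewrite -sum1_count big_mkcond.
rewrite exchange_big -sum1_size; apply: eq_big_seq => y /su yu /=.
rewrite -big_mkcond sum1_count.
by rewrite -(eq_count (fun x => eq_sym x y)) count_uniq_mem ?yu.
Qed.

(** Induction on the length of the word, sorting its rearrangements by their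
    first letter [x]: each [x] contributes [count x s] times [(N-1)!], and the
    counts add up to [N].  The product runs over a fixed list [u], not over
    the letters of [s], because a letter may disappear when [x] is removed. *)
Lemma size_permutations_mul_fact (T : eqType) (u s : seq T) :
  uniq u -> {subset s <= u} ->
  size (permutations s) * \prod_(y <- u) (count_mem y s)`! = (size s)`!.
Proof.
move=> u_uniq; have [n] := ubnP (size s); elim: n s => // n IHn s.
case: (posnP (size s)) => [/size0nil -> _ _|s_gt0 lt_s su].
  by rewrite big1.
rewrite (perm_size (permutationsE s_gt0)) size_allpairs_dep sumnE big_map.
rewrite big_distrl /=.
(* Fixing the first letter x, the factorials of the counts of s and of the
   word left over differ by the factor count x s. *)
have first_letter x : x \in undup s ->
    size (permutations (rem x s)) * \prod_(y <- u) (count_mem y s)`! =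
    count_mem x s * (size s).-1`!.
  rewrite mem_undup => xs; rewrite -(size_rem xs).
  rewrite -(IHn (rem x s)); last 2 first.
  - by rewrite size_rem // -ltnS prednK.
  - by move=> z /mem_rem /su.
  rewrite mulnCA; congr (_ * _).
  rewrite !(bigD1_seq x (su x xs) u_uniq) /= count_mem_rem eqxx subn1 mulnA.
  have cx : 0 < count_mem x s by rewrite -has_count has_pred1.
  rewrite -[in X in _ = X * _ * _](prednK cx) -factS prednK //.
  congr (_ * _); apply: eq_bigr => y /negPf ne_yx.
  by rewrite count_mem_rem eq_sym ne_yx subn0.
rewrite (eq_big_seq _ first_letter) -big_distrl /=.
rewrite (sum_count_mem _ _ _ (undup_uniq s)); last by move=> x; rewrite mem_undup.
by rewrite -[in RHS](prednK s_gt0) factS prednK.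
Qed.

Lemma multinomial_Mult_seq_mset (T : choiceType) (s : seq T) :
  multinomial (size s) (Mult (seq_mset s)) = size (permutations s).
Proof.
have us : uniq (finsupp (seq_mset s)) by exact: fset_uniq.
have sub : {subset s <= finsupp (seq_mset s)}.
  by move=> x xs; rewrite msuppE (perm_mem (perm_eq_seq_mset s)).
rewrite /multinomial /Mult.
rewrite !(perm_big _ (perm_eq_seq_mset _)) /= !big_map.
under eq_bigr do rewrite mset_seqE.
under [X in _ %/ X]eq_bigr do rewrite mset_seqE.
rewrite (sum_count_mem _ _ _ us sub).
rewrite eqxx -(size_permutations_mul_fact _ _ _ us sub) mulnK //.
by apply: prodn_gt0 => x; exact: fact_gt0.
Qed.

End Multinomial.

Section Classes.
Variables (K : choiceType) (m n : nat).
Implicit Types (A B : 'M[K]_(m, n)) (V : {fset 'rV[K]_n}).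

Definition cols A : seq 'cV[K]_m := [seq col j A | j <- enum 'I_n].

Lemma cols_inj : injective cols.
Proof.
move=> A B eqAB; apply/matrixP => i j.
have /matrixP/(_ i ord0) : col j A = col j B.
  by move/eq_in_map: eqAB; apply; rewrite mem_enum.
by rewrite !mxE.
Qed.

Lemma perm_cols A t :
  perm_eq t (cols A) -> exists s : 'S_n, t = cols (col_perm s A).
Proof.
move=> /(@tuple_permP _ _ _ [tuple col j A | j < n]) [s ->]; exists s.
by apply: eq_map => j; rewrite tnth_mktuple; apply/colP => i; rewrite !mxE.
Qed.

(** Permuting columns moves every row by the same permutation, so invariance
    of [V] applies row by row. *)
Lemma col_perm_rows_in V A (s : 'S_n) :
  Sn_invariant V -> A \in rows_in m V -> col_perm s A \in rows_in m V.
Proof.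
rewrite !in_rows_in => Vinv /forallP AV; apply/forallP => i.
rewrite -Vinv; apply/imfset2P; exists (row i A); first exact: AV.
by exists s; [rewrite inE | apply/rowP => j; rewrite !mxE].
Qed.

(** A matrix is determined by its word of columns, and a rearrangement of that
    word comes from a column permutation, which stays within the matrices with
    rows in [V]; so the class is in bijection with the rearrangements. *)
Lemma card_c_class V A :
  Sn_invariant V -> A \in rows_in m V ->
  #|` [fset B in rows_in m V | c_equiv A B]| = multinomial n (Mult (col_mset A)).
Proof.
move=> Vinv AV.
have -> : multinomial n (Mult (col_mset A)) = size (permutations (cols A)).
  by rewrite -multinomial_Mult_seq_mset size_map size_enum_ord.
rewrite -(size_map cols); apply: perm_size; apply: uniq_perm.
- by rewrite map_inj_uniq ?fset_uniq //; exact: cols_inj.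
- exact: permutations_uniq.
move=> t; rewrite mem_permutations; apply/mapP/idP => [[B]|/[dup] tA].
  by rewrite !inE => /andP[_ /eqP/eq_seq_msetP AB] ->; rewrite perm_sym.
move=> /perm_cols [s def_t]; exists (col_perm s A) => //.
rewrite !inE col_perm_rows_in //=; apply/eqP/eq_seq_msetP.
by rewrite -/(cols _) -/(cols (col_perm s A)) -def_t perm_sym.
Qed.

Lemma card_rows_in V : #|` rows_in m V| = #|` V| ^ m.
Proof.
rewrite card_imfset /=; last first.
  move=> r1 r2 /matrixP eq_r; apply/ffunP => i; apply/val_inj/rowP => j.
  by have := eq_r i j; rewrite !mxE.
by rewrite -cardE cardsT card_ffun card_ord cardfE.
Qed.

Lemma rc_class_eq V A B :
  B \in rows_in m V -> (rc_class V B == rc_class V A) = rc_equiv A B.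
Proof.
move=> BV; apply/eqP/idP => [eqBA|/andP[/eqP rAB /eqP cAB]].
  have : B \in rc_class V B by rewrite !inE BV /rc_equiv /r_equiv /c_equiv !eqxx.
  by rewrite eqBA !inE => /andP[].
by apply/fsetP => C; rewrite !inE /rc_equiv /r_equiv /c_equiv rAB cAB.
Qed.

Lemma sum_card_rc_classes V : \sum_(C <- rc_classes m V) #|` C| = #|` V| ^ m.
Proof.
rewrite -card_rows_in card_fset_sum1 (partition_big_imfset _ (rc_class V)).
apply: eq_big_seq => C /imfsetP [A /= AV ->].
rewrite big_fset_condE -card_fset_sum1; congr #|` _|; apply/fsetP => B.
rewrite !inE.
by case: (boolP (B \in _)) => //= BV; rewrite rc_class_eq.
Qed.

Lemma row_f_const A c :
  (forall i, mset_of_row (row i A) = c) -> row_f A = seq_mset (nseq m c).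
Proof.
move=> rowA; congr seq_mset.
rewrite -[in RHS](size_enum_ord m) -(size_map (fun i => mset_of_row (row i A))).
by apply/all_pred1P/allP => _ /mapP[i _ ->]; rewrite /= rowA.
Qed.

End Classes.

Lemma size_permutations_nseq (T : eqType) (m : nat) (c : T) :
  size (permutations (nseq m c)) = 1.
Proof.
suff /perm_size -> : perm_eq (permutations (nseq m c)) [:: nseq m c] by [].
apply: uniq_perm => // [|t]; first exact: permutations_uniq.
rewrite mem_permutations inE; apply/idP/eqP => [tc|-> //].
rewrite -[in RHS](size_nseq m c) -(perm_size tc); apply/all_pred1P.
by rewrite (perm_all _ tc) all_pred1_nseq.
Qed.

(** The counting identity holds for every invariant [V] whose vectors share one
    multiset of entries: the row factors are then 1 and the column factors are
    the sizes of the classes. *)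
Lemma sum_multinomial_rc_classes (K : choiceType) (m n : nat)
    (V : {fset 'rV[K]_n}) (c : {mset K})
    (rep : {fset 'M[K]_(m, n)} -> 'M[K]_(m, n)) :
  Sn_invariant V -> (forall r, r \in V -> mset_of_row r = c) ->
  (forall C, C \in rc_classes m V -> rep C \in C) ->
  \sum_(C <- rc_classes m V)
    multinomial m (Mult (row_f (rep C))) *
    multinomial n (Mult (col_mset (rep C))) = #|` V| ^ m.
Proof.
move=> Vinv Vc repP; rewrite -sum_card_rc_classes; apply: eq_big_seq => C CV.
have row_fV A : A \in rows_in m V -> row_f A = seq_mset (nseq m c).
  by rewrite in_rows_in => /forallP AV; apply: row_f_const => i; apply: Vc.
have := repP C CV; case/imfsetP: CV => A /= AV -> .
set B := rep _; rewrite !inE => /andP[BV /andP[_ /eqP cAB]].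
rewrite (row_fV _ BV) -{1}(size_nseq m c) multinomial_Mult_seq_mset.
rewrite size_permutations_nseq mul1n -cAB -(card_c_class _ _ _ V) //.
congr #|` _|; apply/fsetP => D; rewrite !inE.
case: (boolP (D \in _)) => //= DV.
by rewrite /rc_equiv /r_equiv (row_fV _ AV) (row_fV _ DV) eqxx.
Qed.

Section OneMarkedEntry.
Variables (K : choiceType) (x y : K) (n : nat).

Definition marked_row (j : 'I_n) : 'rV[K]_n :=
  \row_k (if k == j then x else y).

Definition marked_rows : {fset 'rV[K]_n} := [fset marked_row j | j in 'I_n].

Lemma col_perm_marked_row (s : 'S_n) j :
  col_perm s (marked_row (s j)) = marked_row j.
Proof. by apply/rowP => k; rewrite !mxE (inj_eq perm_inj). Qed.

Lemma marked_rows_invariant : Sn_invariant marked_rows.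
Proof.
apply/fsetP => r; apply/imfset2P/imfsetP => /= [[_ /imfsetP[/= j _ ->]]|].
  case=> s _ ->; exists ((s^-1)%g j) => //.
  by rewrite -[in RHS](col_perm_marked_row s) permKV.
case=> j _ ->; exists (marked_row j); first by apply/imfsetP; exists j.
exists 1%g; first by rewrite inE.
by rewrite -[in LHS](col_perm_marked_row 1%g) perm1.
Qed.

Lemma card_marked_rows : (1 < n -> x <> y) -> #|` marked_rows| = n.
Proof.
move=> xy; rewrite card_imfset /=; first by rewrite -cardE card_ord.
move=> i j /rowP/(_ i); rewrite !mxE eqxx; case: eqP => // _ eq_xy.
have n_le1 : n <= 1 by rewrite leqNgt; apply/negP => /xy.
have ord_eq0 (k : 'I_n) : val k = 0.
  by apply/eqP; rewrite -leqn0 -ltnS (leq_trans (ltn_ord k)).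
by apply: val_inj; rewrite !ord_eq0.
Qed.

(** Two marked rows differ by the transposition of the marked positions. *)
Lemma mset_of_marked_row i j :
  mset_of_row (marked_row i) = mset_of_row (marked_row j).
Proof.
apply/eq_seq_msetP.
rewrite -(col_perm_marked_row (tperm i j)) tpermL.
have -> : [seq col_perm (tperm i j) (marked_row j) ord0 k | k <- enum 'I_n] =
    [seq marked_row j ord0 k | k <- [seq tperm i j k | k <- enum 'I_n]].
  by rewrite -[RHS]map_comp; apply: eq_map => k; rewrite /= [LHS]mxE.
apply: perm_map; apply: uniq_perm.
- by rewrite (map_inj_uniq (@perm_inj _ _)) enum_uniq.
- exact: enum_uniq.
move=> k; rewrite mem_enum inE; apply/mapP.
by exists (tperm i j k); rewrite ?mem_enum ?tpermK.
Qed.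

End OneMarkedEntry.

Theorem theorem3p1 (m s : nat) (m_gt0 : 0 < m) (s_gt0 : 0 < s)
    (K : Type) (K_nonempty : inhabited K)
    (K_large : 1 < s -> exists x y : K, x <> y) :
  exists (n : nat) (V : {fset 'rV[{classic K}]_n}),
    [/\ 0 < n, Sn_invariant V, #|` V| = s
      & forall rep : {fset 'M[{classic K}]_(m, n)} -> 'M[{classic K}]_(m, n),
          (forall C, C \in rc_classes m V -> rep C \in C) ->
          s ^ m = \sum_(C <- rc_classes m V)
                    multinomial m (Mult (row_f (rep C))) *
                    multinomial n (Mult (col_mset (rep C)))].
Proof.
have [x [y xy]] : exists x y : {classic K}, 1 < s -> x <> y.
  (* For s = 1 the only row is (x), and y may equal x. *)
  case: (ltnP 1 s) => [/K_large [x [y xy]]|_]; first by exists x, y.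
  by case: K_nonempty => a; exists a, a.
have cardV := card_marked_rows _ x y s xy.
exists s, (marked_rows _ x y s); split=> //; first exact: marked_rows_invariant.
move=> rep repP; rewrite -[in LHS]cardV; apply/esym.
have Vinv := marked_rows_invariant _ x y s.
apply: (sum_multinomial_rc_classes _ _ _ _ _ _ Vinv _ repP) => r.
case/imfsetP => /= j _ ->; exact: mset_of_marked_row (Ordinal s_gt0).
Qed.
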